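(* Let $\{U_\sigma(t,0)\}_{t\ge 0}$, $\sigma\in\Sigma$, be the family of continuous processes on $E=\ell^2$ generated by the nonautonomous lattice system $\dot u=f(u)+\sigma(t)$, as described in the context. Assume that the family has a bounded uniformly (w.r.t. $\sigma\in\Sigma$) absorbing set $B_0\subset E$ and that $$\lim_{t\to+\infty}\ \lim_{M\to+\infty}\ \sup_{u\in B_0}\sum_{|m|>M}\big|\big(U_\sigma(t,0)u\big)_m\big|^2=0\qquad\text{for all }\sigma\in\Sigma .$$ Then for any $\varepsilon>0$ there exists a family of sets $\{\mathcal A_\varepsilon(\sigma)\}_{\sigma\in\Sigma}$ in $E$ with $$A(\sigma)\subset\mathcal A_\varepsilon(\sigma)\subset\mathcal N_\varepsilon(\sigma)\qquad\text{for all }\sigma\in\Sigma,$$ which is forward invariant for $\{U_\sigma(t,0)\}_{t\ge0}$, $\sigma\in\Sigma$. Here $\{A(\sigma)\}_{\sigma\in\Sigma}$ is the pullback attractor of the family of processes and $\mathcal N_\varepsilon(\sigma)$ denotes the $\sigma$-section of the $\varepsilon$-neighborhood of $\bigcup_{\sigma\in\Sigma}(A(\sigma)\times\{\sigma\})$ in $E\times\Sigma$. Furthermore, $\{\mathcal A_\varepsilon(\sigma)\}_{\sigma\in\Sigma}$ uniformly (w.r.t. $\sigma\in\Sigma$) forward attracts each bounded set $B\subset E$: $$\lim_{t\to+\infty}\ \sup_{\sigma\in\Sigma}\mathrm d_H\big(U_\sigma(t,0)B,\mathcal A_\varepsilon(\theta_t\sigma)\big)=0 .$$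
   Context: $E=\ell^2=\{u=(u_m)_{m\in\mathbb Z}: u_m\in\mathbb R,\ \sum_m u_m^2<\infty\}$ with its usual inner product and norm. For $A,B\subset E$, $\mathrm d_H(A,B)=\sup_{x\in A}\inf_{y\in B}\|x-y\|$ (Hausdorff semidistance). The $\varepsilon$-neighborhood of a subset $A$ of a metric space is the set of points at distance $<\varepsilon$ from $A$. Symbol space: a function $g\in L^2_{loc}(\mathbb R,E)$ is translation compact if $\{g(\tau+\cdot):\tau\in\mathbb R\}$ is precompact in $L^2_{loc}(\mathbb R,E)$. Fix a translation compact $\sigma_0$, and let $\Sigma$ be the closure of $\{\sigma_0(s+\cdot):s\in\mathbb R\}$ in $L^2_{loc}(\mathbb R,E)$ (a compact metrizable space, with a metric $\rho$). Put $\theta_t\sigma=\sigma(t+\cdot)$, $t\in\mathbb R$, $\sigma\in\Sigma$. Processes: consider $\dot u=f(u)+\sigma(t)$ for $t>t_0$, $u(t_0)=u_0\in E$, where $f:E\to E$. It is a standing assumption that for each $u_0\in E$, $\sigma\in\Sigma$, $t_0\in\mathbb R$ there is a unique solution $u(t)=u(t,t_0;u_0,\sigma)$, continuous from $[t_0,\infty)$ to $E$ with $u(t_0)=u_0$; write $U_\sigma(t,t_0)u_0=u(t,t_0;u_0,\sigma)$ for $t\ge t_0$. Then $U_\sigma(t,s)U_\sigma(s,\tau)=U_\sigma(t,\tau)$, $U_\sigma(\tau,\tau)=\mathrm{Id}$ and $U_\sigma(t+s,\tau+s)=U_{\theta_s\sigma}(t,\tau)$. It is also assumed that the processes are continuous: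 for each $t\ge0$ the map $(u,\sigma)\mapsto U_\sigma(t,0)u$ is continuous from $E\times\Sigma$ to $E$. A set $B_0\subset E$ is uniformly (w.r.t. $\sigma\in\Sigma$) absorbing if for each $\tau\in\mathbb R$ and bounded $B\subset E$ there is $t_0=t_0(\tau,B)\ge\tau$ with $\bigcup_{\sigma\in\Sigma}U_\sigma(t,\tau)B\subset B_0$ for all $t\ge t_0$. The skew-product flow is the semigroup $\Psi(t)(u,\sigma)=(U_\sigma(t,0)u,\theta_t\sigma)$, $t\ge0$, on $E\times\Sigma$ (with a standard product metric). Under the hypotheses of the theorem $\Psi$ has a global attractor (compact, invariant, attracting bounded sets) of the form $\bigcup_{\sigma\in\Sigma}(A(\sigma)\times\{\sigma\})$; its $\sigma$-sections $\{A(\sigma)\}_{\sigma\in\Sigma}$ form the pullback attractor of $\{U_\sigma(t,0)\}_{t\ge0}$, $\sigma\in\Sigma$. The $\sigma$-section of $S\subset E\times\Sigma$ is $\{u\in E:(u,\sigma)\in S\}$. A family $\{\mathcal C(\sigma)\}_{\sigma\in\Sigma}$ of subsets of $E$ is forward invariant if $U_\sigma(t,0)\mathcal C(\sigma)\subset\mathcal C(\theta_t\sigma)$ for all $t\ge0$, $\sigma\in\Sigma$. *)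

(* Defs.v *)
From HB Require Import structures.
From mathcomp Require Import all_boot all_order all_algebra.
From mathcomp Require Import all_classical all_reals all_analysis.
From mathcomp Require Import measurable_realfun.
From mathcomp Require Import ring lra.

Set Implicit Arguments.
Unset Strict Implicit.
Unset Printing Implicit Defensive.

Import Order.TTheory GRing.Theory Num.Theory.
Import numFieldNormedType.Exports.

Local Open Scope classical_set_scope.
Local Open Scope ring_scope.

Section weighted_square.
Variable R : realType.

Lemma sqrD_le (l x y : R) : 0 < l ->
  (x + y) ^+ 2 <= (1 + l) * x ^+ 2 + (1 + l^-1) * y ^+ 2.
Proof.
move=> l0; rewrite -subr_ge0.
rewrite [X in 0 <= X](_ : _ = (l * x - y) ^+ 2 / l); last by field; rewrite gt_eqF.
by rewrite divr_ge0 ?sqr_ge0 ?ltW.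
Qed.

End weighted_square.

Section ell2.
Variable R : realType.

Definition sqsum (u : int -> R) : \bar R := \esum_(m in [set: int]) (u m ^+ 2)%:E.

Lemma sqsum_ge0 u : (0 <= sqsum u)%E.
Proof. by apply: esum_ge0 => m _; rewrite lee_fin sqr_ge0. Qed.

Lemma sqsum_coord u m : ((u m ^+ 2)%:E <= sqsum u)%E.
Proof.
apply: esum_ge; exists [set m]; first by split => //; exact: finite_set1.
by rewrite fsbig_set1.
Qed.

Lemma sqsum0 : sqsum (0 : int -> R) = 0%E.
Proof. by apply: esum1 => m _ /=; rewrite expr0n. Qed.

Let sqsumZ_le (a : R) u : (sqsum (a *: u) <= (a ^+ 2)%:E * sqsum u)%E.
Proof.
apply: ge_ereal_sup => _ [X [finX _] <-].
rewrite [leLHS](_ : _ = ((a ^+ 2)%:E * \sum_(i \in X) (u i ^+ 2)%:E)%E).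
  apply: lee_wpmul2l; first by rewrite lee_fin sqr_ge0.
  by apply: ereal_sup_ubound; exists X.
rewrite ge0_mule_fsumr; last by move=> i; rewrite lee_fin sqr_ge0.
by apply: eq_fsbigr => i _; rewrite -EFinM -exprMn.
Qed.

Lemma sqsumZ (a : R) u : (sqsum (a *: u) = (a ^+ 2)%:E * sqsum u)%E.
Proof.
have [->|a0] := eqVneq a 0; first by rewrite scale0r sqsum0 expr0n mul0e.
apply/eqP; rewrite eq_le sqsumZ_le/=.
have /(lee_wpmul2l (_ : 0 <= (a ^+ 2)%:E)%E) := sqsumZ_le a^-1 (a *: u).
rewrite scalerK// muleA -EFinM -exprMn divff// expr1n mul1e; apply.
by rewrite lee_fin sqr_ge0.
Qed.

Lemma sqsumD_le (l : R) (u v : int -> R) : 0 < l ->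
  (sqsum (u + v)%R <= (1 + l)%:E * sqsum u + (1 + l^-1)%:E * sqsum v)%E.
Proof.
move=> l0; have l1 : 0 <= 1 + l by rewrite addr_ge0 ?ltW.
have l2 : 0 <= 1 + l^-1 by rewrite addr_ge0 ?invr_ge0 ?ltW.
rewrite -(sqr_sqrtr l1) -(sqr_sqrtr l2) -!sqsumZ -esumD => [|i _|i _].
- apply: le_esum => i _; rewrite -EFinD lee_fin.
  rewrite [(_ *: u) i]/(Num.sqrt _ * u i) [(_ *: v) i]/(Num.sqrt _ * v i).
  by rewrite !exprMn !sqr_sqrtr// sqrD_le.
- by rewrite lee_fin sqr_ge0.
- by rewrite lee_fin sqr_ge0.
Qed.

(* Real sequences indexed by the integers that are square summable. *)
Definition ell2_pred : {pred int -> R} := mem [set u | (sqsum u < +oo)%E].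

Record ell2 : predArgType := Ell2 { ell2_val :> int -> R; _ : ell2_val \in ell2_pred }.

HB.instance Definition _ := [isSub for ell2_val].
HB.instance Definition _ := [Choice of ell2 by <:].

Lemma ell2_submod_closed : submod_closed ell2_pred.
Proof.
split=> [|a u v]; first by rewrite !inE /= sqsum0.
rewrite !inE /= => u2 v2.
apply: le_lt_trans (sqsumD_le _ _ ltr01) _.
rewrite sqsumZ lte_add_pinfty// !lte_mul_pinfty ?lee_fin ?sqr_ge0//.
Qed.

HB.instance Definition _ :=
  GRing.isSubmodClosed.Build R (int -> R) ell2_pred ell2_submod_closed.
HB.instance Definition _ := [SubChoice_isSubLmodule of ell2 by <:].

Lemma ell2_sqsum_lty (u : ell2) : (sqsum u < +oo)%E.
Proof. by have := valP u; rewrite inE. Qed.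

Definition ell2_norm (u : ell2) : R := Num.sqrt (fine (sqsum u)).

Lemma ell2_norm_ge0 u : 0 <= ell2_norm u.
Proof. exact: sqrtr_ge0. Qed.

Lemma ell2_norm_sqr (u : ell2) : (ell2_norm u ^+ 2)%:E = sqsum u.
Proof.
rewrite sqr_sqrtr ?fine_ge0 ?sqsum_ge0// fineK// ge0_fin_numE ?sqsum_ge0//.
exact: ell2_sqsum_lty.
Qed.

Lemma ell2_normZ (a : R) (u : ell2) : ell2_norm (a *: u) = `|a| * ell2_norm u.
Proof.
rewrite /ell2_norm -sqrtr_sqr -sqrtrM ?sqr_ge0//; congr (Num.sqrt _).
by rewrite (_ : ell2_val _ = a *: (u : int -> R))// sqsumZ -ell2_norm_sqr.
Qed.

Lemma ell2_normD (u v : ell2) : ell2_norm (u + v) <= ell2_norm u + ell2_norm v.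
Proof.
apply/ler_addgt0Pl => e e0.
set a := ell2_norm u + e / 2; set b := ell2_norm v + e / 2.
have e20 : 0 < e / 2 by rewrite divr_gt0.
have a0 : 0 < a by rewrite ltr_wpDl ?ell2_norm_ge0.
have b0 : 0 < b by rewrite ltr_wpDl ?ell2_norm_ge0.
rewrite [leRHS](_ : _ = a + b); last by rewrite /a /b; field.
have ab0 : 0 <= a + b by rewrite addr_ge0 ?ltW.
rewrite -ler_sqr ?nnegrE ?ell2_norm_ge0//.
rewrite -lee_fin ell2_norm_sqr (_ : ell2_val (u + v) = (u : int -> R) + v)//.
have := @sqsumD_le (b / a) u v (divr_gt0 b0 a0).
move/le_trans; apply; rewrite -!ell2_norm_sqr -!EFinM -EFinD lee_fin invf_div.
have ua : ell2_norm u ^+ 2 <= a ^+ 2.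
  by rewrite ler_sqr ?nnegrE ?ell2_norm_ge0 ?(ltW a0)// lerDl ltW.
have vb : ell2_norm v ^+ 2 <= b ^+ 2.
  by rewrite ler_sqr ?nnegrE ?ell2_norm_ge0 ?(ltW b0)// lerDl ltW.
rewrite [leRHS](_ : _ = (1 + b / a) * a ^+ 2 + (1 + a / b) * b ^+ 2); last first.
  by field; rewrite !gt_eqF.
by rewrite lerD// ler_wpM2l// addr_ge0// divr_ge0 ?ltW.
Qed.

Lemma ell2_norm0_eq0 (u : ell2) : ell2_norm u = 0 -> u = 0.
Proof.
move=> u0; apply/val_inj/funext => m /=.
have := sqsum_coord u m; rewrite -ell2_norm_sqr u0 expr0n lee_fin => um.
by apply/eqP; rewrite -sqrf_eq0 eq_le um sqr_ge0.
Qed.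

HB.instance Definition _ := Lmodule_isNormed.Build R ell2
  ell2_normD ell2_normZ ell2_norm0_eq0.

Lemma ell2_normE (u : ell2) : (`|u| ^+ 2)%:E = sqsum u.
Proof. exact: ell2_norm_sqr. Qed.

Lemma ell2_coord_le (u : ell2) m : `|u m| <= `|u|.
Proof.
rewrite -ler_sqr ?nnegrE// -lee_fin ell2_normE real_normK ?num_real//.
exact: sqsum_coord.
Qed.

End ell2.

Section L2loc.
Variable R : realType.
Local Notation mu := (@lebesgue_measure R).
Local Notation E := (ell2 R).

(* As ell2 is separable, Borel measurability of an ell2-valued function is its
   strong (Bochner) measurability. Elements of L^2_loc(R, ell2) are the classes
   of these functions modulo equality almost everywhere. *)
Record L2loc_fun : Type := L2locFun {
  L2loc_val :> R -> E ;
  L2loc_borel : forall O : set E, open O -> measurable (L2loc_val @^-1` O) ;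
  L2loc_fin : forall a b : R, (\int[mu]_(x in `[a, b]) (`|L2loc_val x| ^+ 2)%:E < +oo)%E }.

HB.instance Definition _ := gen_eqMixin L2loc_fun.
HB.instance Definition _ := gen_choiceMixin L2loc_fun.

#[local] Instance ae_lebesgue_filter : Filter (almost_everywhere mu).
Proof. exact: ae_filter_ringOfSetsType. Qed.

Definition L2loc_ae_eq (f g : L2loc_fun) : bool := `[< {ae mu, forall x, f x = g x} >].

Let ae_eq_refl : reflexive L2loc_ae_eq.
Proof. by move=> f; apply/asboolP; exact: aeW. Qed.

Let ae_eq_sym : symmetric L2loc_ae_eq.
Proof.
by move=> f g; apply/idP/idP => /asboolP fg; apply/asboolP; apply: filterS fg => x ->.
Qed.

Let ae_eq_trans : transitive L2loc_ae_eq.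
Proof.
move=> g f h /asboolP fg /asboolP gh; apply/asboolP.
by apply: filterS2 fg gh => x -> ->.
Qed.

Canonical L2loc_ae_eq_canonical :=
  EquivRel L2loc_ae_eq ae_eq_refl ae_eq_sym ae_eq_trans.

Local Open Scope quotient_scope.

Definition L2loc : Type := {eq_quot L2loc_ae_eq}.
HB.instance Definition _ := Choice.on L2loc.
HB.instance Definition _ := EqQuotient.on L2loc.

Definition L2loc_repr (f : L2loc) : L2loc_fun := repr f.
Coercion L2loc_repr : L2loc >-> L2loc_fun.

Lemma L2loc_eqP (f g : L2loc) : f = g <-> {ae mu, forall x, f x = g x}.
Proof.
split=> [->|fg]; first exact: aeW.
by rewrite -(reprK f) -(reprK g); apply/eqmodP/asboolP.
Qed.

Lemma L2loc_piE (f : L2loc_fun) : {ae mu, forall x, (\pi_L2loc f : L2loc) x = f x}.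
Proof.
have /eqmodP/asboolP := reprK (\pi_L2loc f).
exact.
Qed.

Definition int_sqdist (a b : R) (f g : R -> E) : \bar R :=
  (\int[mu]_(x in `[a, b]) (`|f x - g x| ^+ 2)%:E)%E.
Arguments int_sqdist (a b)%_ring_scope f g.

Lemma int_sqdist_ge0 s t f g : (0 <= int_sqdist s t f g)%E.
Proof. by apply: integral_ge0 => x _; rewrite lee_fin sqr_ge0. Qed.

Lemma int_sqdistC s t f g : int_sqdist s t f g = int_sqdist s t g f.
Proof. by apply: eq_integral => x _; rewrite distrC. Qed.

Lemma int_sqdistxx s t f : int_sqdist s t f f = 0%E.
Proof. by apply: integral0_eq => x _; rewrite subrr normr0 expr0n. Qed.

Lemma coord_continuous (m : int) : continuous (fun u : E => u m).
Proof.
move=> u V /nbhs_ballP[e /= e0 eV]; apply/(@nbhs_ballP R E); exists e => //= v uv.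
apply: eV; rewrite -ball_normE/=; apply: le_lt_trans (ell2_coord_le (u - v) m) _.
by move: uv; rewrite -ball_normE.
Qed.

Lemma measurable_coord (f : L2loc_fun) (m : int) :
  measurable_fun setT (fun x => f x m).
Proof.
apply: (measurability _ (RGenOpens.measurableE R)) => _ [_ [x [y ->] <-]].
rewrite setTI; apply: (@L2loc_borel f ((fun u : E => u m) @^-1` `]x, y[%classic)).
by apply: open_comp => [u _|]; [exact: coord_continuous|exact: interval_open].
Qed.

Let int_of_nat (n : nat) : int := if odd n then Negz n./2 else Posz n./2.

Let int_of_nat_bij : set_bij [set: nat] [set: int] int_of_nat.
Proof.
split => //.
- move=> i j _ _; rewrite /int_of_nat => ij.
  rewrite -(odd_double_half i) -(odd_double_half j); move: ij.
  by case: (odd i); case: (odd j) => // -[->].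
- case=> n _; [exists n.*2|exists n.*2.+1] => //; rewrite /int_of_nat/=.
    by rewrite odd_double doubleK.
  by rewrite odd_double/= uphalf_double.
Qed.

Let sqnorm_series (u : E) :
  (`|u| ^+ 2)%:E = (\sum_(0 <= n <oo) (u (int_of_nat n) ^+ 2)%:E)%E.
Proof.
rewrite ell2_normE /sqsum (reindex_esum _ _ _ _ int_of_nat_bij).
by rewrite -nneseries_esumT// => n; rewrite lee_fin sqr_ge0.
Qed.

Lemma measurable_sqnorm (f : L2loc_fun) :
  measurable_fun setT (fun x : R => (`|f x| ^+ 2)%:E : \bar R).
Proof.
under eq_fun do rewrite sqnorm_series.
apply: ge0_emeasurable_sum => [k x _ _|k _]; first by rewrite lee_fin sqr_ge0.
by apply/measurable_EFinP; apply: measurable_funX; exact: measurable_coord.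
Qed.

Lemma measurable_sqdist (f g : L2loc_fun) :
  measurable_fun setT (fun x : R => (`|f x - g x| ^+ 2)%:E : \bar R).
Proof.
under eq_fun do rewrite sqnorm_series.
apply: ge0_emeasurable_sum => [k x _ _|k _]; first by rewrite lee_fin sqr_ge0.
apply/measurable_EFinP; apply: measurable_funX.
by apply: measurable_funB; exact: measurable_coord.
Qed.

Lemma int_sqdist_triangle (s t : R) (f g h : L2loc_fun) (a b : R) :
  0 < a -> 0 < b ->
  (int_sqdist s t f g < (a ^+ 2)%:E)%E -> (int_sqdist s t g h < (b ^+ 2)%:E)%E ->
  (int_sqdist s t f h < ((a + b) ^+ 2)%:E)%E.
Proof.
move=> a0 b0 fg gh; set D := `[s, t]%classic : set R.
have mD : measurable D by exact: measurable_itv.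
have l0 : 0 < b / a by rewrite divr_gt0.
have k1 : 0 < 1 + b / a by rewrite addr_gt0.
have k2 : 0 < 1 + a / b by rewrite addr_gt0// divr_gt0.
have mS (u v : L2loc_fun) := measurable_funS measurableT (@subsetT _ D) (measurable_sqdist u v).
apply: (@le_lt_trans _ _ ((1 + b / a)%:E * int_sqdist s t f g +
                         (1 + a / b)%:E * int_sqdist s t g h)%E); last first.
  rewrite [X in (_ < X)%E](_ : _ = (1 + b / a)%:E * (a ^+ 2)%:E +
     (1 + a / b)%:E * (b ^+ 2)%:E)%E; last first.
    by rewrite -!EFinM -EFinD; congr EFin; field; rewrite !gt_eqF.
  by apply: lteD; rewrite lte_pmul2l.
have mZ (c : R) (u v : L2loc_fun) :
    measurable_fun D (fun x : R => (c%:E * (`|u x - v x| ^+ 2)%:E)%E).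
  by apply: emeasurable_funM => //; exact: mS.
have Z (c : R) (u v : L2loc_fun) : 0 < c -> (c%:E * int_sqdist s t u v)%E =
    (\int[mu]_(x in D) (c%:E * (`|u x - v x| ^+ 2)%:E))%E.
  move=> c0; apply/esym/ge0_integralZl => //; first exact: mS.
  by rewrite lee_fin ltW.
have Z0 (c : R) (u v : L2loc_fun) (x : R) : 0 < c ->
    (0 <= c%:E * (`|u x - v x| ^+ 2)%:E)%E.
  by move=> c0; rewrite -EFinM lee_fin mulr_ge0 ?sqr_ge0// ltW.
rewrite !Z// /int_sqdist -/D -ge0_integralD//;
  try by [exact: mZ | move=> x _; exact: Z0].
apply: ge0_le_integral => //; try by [exact: mS | move=> x _; rewrite lee_fin sqr_ge0
  | move=> x _; rewrite adde_ge0// Z0 | apply: emeasurable_funD; exact: mZ].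
move=> x _; rewrite -!EFinM -EFinD lee_fin.
have := sqrD_le `|f x - g x| `|g x - h x| l0; rewrite invf_div.
apply: le_trans; rewrite ler_sqr ?nnegrE ?addr_ge0//.
by rewrite -[f x - h x](subrKA (g x)) ler_normD.
Qed.

(* The balls of a metric of Levy type. They generate the topology of convergence
   in L^2(-k, k; ell2) for every k, see nbhs_L2locE. *)
Definition L2loc_ball (f : L2loc) (e : R) : set L2loc :=
  [set g | 0 < e /\ (int_sqdist (- e^-1) e^-1 f g < (e ^+ 2)%:E)%E].

Let ball_center (f : L2loc) (e : R) : 0 < e -> L2loc_ball f e f.
Proof. by move=> e0; split => //; rewrite int_sqdistxx lte_fin exprn_gt0. Qed.

Let ball_sym (f g : L2loc) (e : R) : L2loc_ball f e g -> L2loc_ball g e f.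
Proof. by move=> [e0 fg]; split => //; rewrite int_sqdistC. Qed.

Let int_sqdist_sub (f g : L2loc_fun) (a b : R) : a <= b ->
  (int_sqdist (- a) a f g <= int_sqdist (- b) b f g)%E.
Proof.
move=> ab; apply: ge0_subset_integral => //.
- exact: measurable_funS (measurable_sqdist f g).
- by apply: subset_itv; rewrite bnd_simp// lerN2.
Qed.

Let int_sqdist_ball (f g : L2loc_fun) (a b : R) : 0 < a -> a <= b ->
  (int_sqdist (- b^-1) b^-1 f g <= int_sqdist (- a^-1) a^-1 f g)%E.
Proof.
by move=> a0 ab; apply: int_sqdist_sub; rewrite lef_pV2 ?posrE// (lt_le_trans a0).
Qed.

Let ball_triangle (f g h : L2loc) (a b : R) :
  L2loc_ball f a g -> L2loc_ball g b h -> L2loc_ball f (a + b) h.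
Proof.
move=> [a0 fg] [b0 gh]; split; first exact: addr_gt0.
apply: (@int_sqdist_triangle _ _ f g h a b) => //.
- by apply: le_lt_trans fg; apply: int_sqdist_ball; rewrite ?lerDl ?ltW.
- by apply: le_lt_trans gh; apply: int_sqdist_ball; rewrite ?lerDr ?ltW.
Qed.

HB.instance Definition _ := hasNbhs.Build L2loc (nbhs_ (entourage_ L2loc_ball)).
HB.instance Definition _ := @Nbhs_isPseudoMetric.Build R L2loc
  (entourage_ L2loc_ball) erefl L2loc_ball ball_center ball_sym ball_triangle erefl.

Lemma nbhs_L2locE (f : L2loc) (V : set L2loc) : nbhs f V <->
  exists2 e : R, 0 < e & exists k : R,
    [set g : L2loc | (int_sqdist (- k) k f g < e%:E)%E] `<=` V.
Proof.
split=> [fV|[e e0 [k ekV]]].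
  have /(@nbhs_ballP R L2loc)[e /= e0 eV] : nbhs f V by [].
  by exists (e ^+ 2); rewrite ?exprn_gt0//; exists e^-1 => g /= fg; exact: eV.
apply/(@nbhs_ballP R L2loc); pose d := Num.min 1 (Num.min e (`|k| + 1)^-1).
have d0 : 0 < d by rewrite !lt_min ltr01 e0 invr_gt0 ltr_wpDl.
have d1 : d <= 1 by rewrite /d ge_min lexx.
have de : d <= e by rewrite /d !ge_min lexx !orbT.
have dk : k <= d^-1.
  rewrite (le_trans (ler_norm k))// (@le_trans _ _ (`|k| + 1))// ?lerDl//.
  rewrite -[leLHS]invrK lef_pV2 ?posrE ?invr_gt0 ?ltr_wpDl//.
  by rewrite /d !ge_min lexx !orbT.
exists d => //= g [_ fg]; apply: ekV => /=.
apply: le_lt_trans (int_sqdist_sub f g dk) (lt_le_trans fg _).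
by rewrite lee_fin (le_trans _ de)// expr2 ler_piMl// ltW.
Qed.

Lemma measurable_shift (t : R) : measurable_fun setT (fun x : R => t + x).
Proof. by apply: measurable_funD => //; exact: measurable_cst. Qed.

Lemma lebesgue_measure_shift (t : R) (A : set R) : measurable A ->
  pushforward mu ((fun x => t + x) : _ -> measurableTypeR R) A = mu A.
Proof.
move=> mA; apply/esym/lebesgue_measure_unique => //=; first exact: measurable_shift.
move=> _ _ [[a b]] _ <-.
rewrite /pushforward (_ : _ @^-1` _ = `]a - t, b - t]%classic).
  by rewrite !lebesgue_measure_itv/= !lte_fin ltrD2r -!EFinB opprB addrA subrK.
by apply/seteqP; split=> x /=; rewrite !in_itv/= ltrBlDl lerBrDl.
Qed.

Lemma shift_borel (t : R) (f : L2loc_fun) (O : set E) :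
  open O -> measurable ((fun s => f (t + s)) @^-1` O).
Proof.
move=> oO; rewrite -[X in measurable X]setTI.
exact: (measurable_shift t measurableT (L2loc_borel f oO)).
Qed.

Lemma shift_fin (t : R) (f : L2loc_fun) (a b : R) :
  (\int[mu]_(x in `[a, b]) (`|f (t + x)| ^+ 2)%:E < +oo)%E.
Proof.
pose phi : R -> measurableTypeR R := fun x => t + x.
pose S : set (measurableTypeR R) := `[t + a, t + b]%classic.
have mphi : measurable_fun setT phi by exact: measurable_shift.
rewrite (_ : `[a, b]%classic = phi @^-1` S); last first.
  by apply/seteqP; split=> x; rewrite /preimage /S /phi /= !in_itv/= !lerD2l.
have -> : (\int[mu]_(x in phi @^-1` S) (`|f (t + x)| ^+ 2)%:E =
    \int[pushforward mu phi]_(x in S) (`|f x| ^+ 2)%:E)%E.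
  apply/esym; apply: ge0_integral_pushforward => //; first exact: measurable_itv.
  exact: measurable_funS (measurable_sqnorm f).
rewrite (eq_measure_integral lebesgue_measure)//; first exact: L2loc_fin.
by move=> A mA _; exact: lebesgue_measure_shift.
Qed.

Definition shift_fun (t : R) (f : L2loc_fun) : L2loc_fun :=
  L2locFun (@shift_borel t f) (@shift_fin t f).

(* The translate sigma |-> sigma(t + .). *)
Definition theta (t : R) (f : L2loc) : L2loc := \pi_L2loc (shift_fun t f).

Lemma thetaE (t : R) (f : L2loc) : {ae mu, forall s, theta t f s = f (t + s)}.
Proof. exact: L2loc_piE. Qed.

End L2loc.

Section semidistance.
Variables (R : realType) (X : Type).
Variable d : X -> X -> R.

Definition dist_set (x : X) (B : set X) : \bar R :=
  ereal_inf [set (d x y)%:E | y in B].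

(* The supremum is taken in [0, +oo], so that the semidistance from the empty
   set is 0 rather than -oo. *)
Definition semidist (A B : set X) : \bar R :=
  ereal_sup (0%E |` [set dist_set x B | x in A]).

Definition dist_bounded (B : set X) : Prop :=
  exists r : R, forall x y, B x -> B y -> d x y <= r.

Definition neighborhood (S A : set X) (e : R) : set X :=
  [set x | S x /\ (dist_set x A < e%:E)%E].

End semidistance.

Section metric_on.
Variables (R : realType) (T : topologicalType).

Definition metric_on (S : set T) (rho : T -> T -> R) : Prop :=
  [/\ forall x y, S x -> S y -> 0 <= rho x y,
      forall x y, S x -> S y -> (rho x y = 0 <-> x = y),
      forall x y, S x -> S y -> rho x y = rho y x,
      forall x y z, S x -> S y -> S z -> rho x z <= rho x y + rho y z &
      forall x, S x -> forall V : set T, within S (nbhs x) V <->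
        exists2 e : R, 0 < e & forall y, S y -> rho x y < e -> V y].

End metric_on.

Definition section (X Y : Type) (S : set (X * Y)) (y : Y) : set X :=
  [set x | S (x, y)].

Section global_attractor.
Variables (R : realType) (T : topologicalType).

Definition global_attractor (S : set T) (d : T -> T -> R) (Psi : R -> T -> T)
    (A : set T) : Prop :=
  [/\ A `<=` S, compact A,
      forall t, 0 <= t -> Psi t @` A = A &
      forall B, B `<=` S -> dist_bounded d B ->
        semidist d (Psi t @` B) A @[t --> +oo%R] --> 0%E].

End global_attractor.

Section lattice_system.
Variable R : realType.
Local Notation E := (ell2 R).
Local Notation mu := (@lebesgue_measure R).

Definition ell2_dist (u v : E) : R := `|u - v|.

Definition tail (M : nat) (u : E) : \bar R :=
  \esum_(m in [set m : int | (M < `|m|)%N]) (u m ^+ 2)%:E.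

Definition translates (sigma0 : L2loc R) : set (L2loc R) :=
  range (fun s : R => theta s sigma0).

Definition translation_compact (sigma0 : L2loc R) : Prop :=
  precompact (translates sigma0).

Definition hull (sigma0 : L2loc R) : set (L2loc R) := closure (translates sigma0).

(* The intervals [p.1, p.2], p <- s, are listed from left to right and do not
   overlap. *)
Definition absolutely_continuous (a b : R) (u : R -> E) : Prop :=
  forall e : R, 0 < e -> exists2 d : R, 0 < d &
    forall s : seq (R * R),
      all (fun p => [&& a <= p.1, p.1 <= p.2 & p.2 <= b]) s ->
      pairwise (fun p q => p.2 <= q.1) s ->
      \sum_(p <- s) (p.2 - p.1) < d ->
      \sum_(p <- s) `|u p.2 - u p.1| < e.

(* Since sigma is only defined almost everywhere, a solution is meant in the
   sense of Caratheodory. Its values before t0 are irrelevant. *)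
Definition is_solution (f : E -> E) (sigma : L2loc R) (t0 : R) (u0 : E)
    (u : R -> E) : Prop :=
  [/\ u t0 = u0,
      {within `[t0, +oo[, continuous u},
      forall b, t0 <= b -> absolutely_continuous t0 b u &
      {ae mu, forall t : R, t0 < t -> is_derive t (1 : R) u (f (u t) + sigma t)}].

(* [U sigma t t0 u0] is the value at time t >= t0 of the solution that starts
   from u0 at time t0. *)
Definition generated_by (f : E -> E) (Sigma : set (L2loc R))
    (U : L2loc R -> R -> R -> E -> E) : Prop :=
  forall sigma t0 u0, Sigma sigma ->
    is_solution f sigma t0 u0 (fun t => U sigma t t0 u0) /\
    forall v, is_solution f sigma t0 u0 v ->
      forall t, t0 <= t -> v t = U sigma t t0 u0.

Section processes.
Variables (Sigma : set (L2loc R)) (U : L2loc R -> R -> R -> E -> E).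

Definition continuous_processes : Prop :=
  forall t, 0 <= t ->
    {within [set: E] `*` Sigma,
      continuous (fun p : E * L2loc R => U p.2 t 0 p.1)}.

Definition uniformly_absorbing (B0 : set E) : Prop :=
  forall (tau : R) (B : set E), bounded_set B ->
    exists2 t0 : R, tau <= t0 &
      forall t, t0 <= t -> \bigcup_(sigma in Sigma) (U sigma t tau @` B) `<=` B0.

Definition skew_product (t : R) (p : E * L2loc R) : E * L2loc R :=
  (U p.2 t 0 p.1, theta t p.2).

Definition forward_invariant (C : L2loc R -> set E) : Prop :=
  forall t sigma, 0 <= t -> Sigma sigma ->
    U sigma t 0 @` C sigma `<=` C (theta t sigma).

Definition uniformly_forward_attracts (C : L2loc R -> set E) (B : set E) : Prop :=
  ereal_sup [set semidist ell2_dist (U sigma t 0 @` B) (C (theta t sigma)) |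
             sigma in Sigma] @[t --> +oo%R] --> 0%E.

Definition asymptotically_null_tails (B0 : set E) : Prop :=
  forall sigma, Sigma sigma ->
    limn (fun M : nat => ereal_sup [set tail M (U sigma t 0 u) | u in B0])
      @[t --> +oo%R] --> 0%E.

End processes.

Definition prod_dist (rho : L2loc R -> L2loc R -> R) (p q : E * L2loc R) : R :=
  Num.max (ell2_dist p.1 q.1) (rho p.2 q.2).

End lattice_system.

(* Main.v *)
(* A point of [E x Sigma] belongs to [Aeps] when its whole forward orbit under
   the skew-product flow stays in the eps-neighborhood of the global attractor.
   The semigroup property makes [Aeps] forward invariant, and the invariance of
   the attractor puts it inside [Aeps]. Since [Sigma] is compact, [B x Sigma] is
   bounded for every bounded [B]; its orbit therefore enters the neighborhood for
   good at some time [T], so from [T] on it lies in [Aeps] and the semidistance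
   vanishes. The semigroup property itself comes from the uniqueness of
   solutions: translating a solution for [sigma] by [s] gives a solution for
   [theta s sigma]. *)
Require Import Defs.
From mathcomp Require Import all_boot all_order all_algebra.
From mathcomp Require Import all_classical all_reals all_analysis.

Set Implicit Arguments.
Unset Strict Implicit.
Unset Printing Implicit Defensive.

Import Order.TTheory GRing.Theory Num.Theory.
Import numFieldNormedType.Exports.

Local Open Scope classical_set_scope.
Local Open Scope ring_scope.

(** * Translation of symbols and of solutions *)

Section translation.
Variable R : realType.
Local Notation mu := (@lebesgue_measure R).
Local Notation E := (ell2 R).

#[local] Instance ae_lebesgue_filter : Filter (almost_everywhere mu).
Proof. exact: ae_filter_ringOfSetsType. Qed.

(** The exceptional null set is pulled back along the translation, and Lebesgue measure is
    translation invariant. *)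
Lemma ae_shift (t : R) (P : R -> Prop) :
  {ae mu, forall x, P x} -> {ae mu, forall x, P (t + x)}.
Proof.
move=> [N [mN N0 PN]]; exists ((fun x => t + x) @^-1` N); split.
- by rewrite -[X in measurable X]setTI; exact: (measurable_shift t measurableT mN).
- by rewrite -N0 -(lebesgue_measure_shift t mN).
- by move=> x /= Px; exact: PN.
Qed.

Lemma thetaD (s t : R) (f : L2loc R) : theta t (theta s f) = theta (s + t) f.
Proof.
apply/L2loc_eqP.
apply: filterS3 (thetaE t (theta s f)) (ae_shift t (thetaE s f)) (thetaE (s + t) f).
by move=> x -> -> ->; rewrite addrA.
Qed.

Lemma theta0 (f : L2loc R) : theta 0 f = f.
Proof. by apply/L2loc_eqP; apply: filterS (thetaE 0 f) => x ->; rewrite add0r. Qed.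

Lemma int_sqdist_theta (t a b : R) (f g : L2loc R) :
  int_sqdist a b (theta t f) (theta t g) = int_sqdist (t + a) (t + b) f g.
Proof.
rewrite {1}/int_sqdist.
have mS (u v : L2loc_fun R) := measurable_funS measurableT
  (@subsetT _ `[a, b]%classic) (measurable_sqdist u v).
(* [theta t f] is a class whose representative agrees with the shifted function only almost
   everywhere; after this replacement the change of variables applies pointwise. *)
have -> : (\int[mu]_(x in `[a, b]) (`|theta t f x - theta t g x| ^+ 2)%:E =
    \int[mu]_(x in `[a, b]) (`|shift_fun t f x - shift_fun t g x| ^+ 2)%:E)%E.
  apply: ge0_ae_eq_integral => //.
  - exact: mS.
  - exact: mS.
  - by apply: filterS2 (thetaE t f) (thetaE t g) => x /= -> ->.
pose phi : R -> measurableTypeR R := fun x => t + x.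
pose S : set (measurableTypeR R) := `[t + a, t + b]%classic.
have mphi : measurable_fun setT phi by exact: measurable_shift.
rewrite (_ : `[a, b]%classic = phi @^-1` S); last first.
  by apply/seteqP; split=> x; rewrite /preimage /S /phi /= !in_itv/= !lerD2l.
transitivity (\int[pushforward mu phi]_(x in S) (`|f x - g x| ^+ 2)%:E)%E.
  apply/esym; apply: ge0_integral_pushforward => //; first exact: measurable_itv.
  exact: measurable_funS (measurable_sqdist f g).
apply: eq_measure_integral => A mA _; exact: lebesgue_measure_shift.
Qed.

(** Shifting by [t] moves the window [[-k, k]] into [[-(|t| + k), |t| + k]]. A translate of [sigma0]
    close to [sigma] on the larger window therefore stays close on the smaller one once both are
    shifted. *)
Lemma hull_theta (sigma0 : L2loc R) (t : R) (sigma : L2loc R) :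
  hull sigma0 sigma -> hull sigma0 (theta t sigma).
Proof.
move=> hs V /nbhs_L2locE[e e0 [k kV]].
have : nbhs sigma [set g : L2loc R |
    (int_sqdist (- (`|t| + k)) (`|t| + k) sigma g < e%:E)%E].
  by apply/nbhs_L2locE; exists e; last by exists (`|t| + k); exact: subset_refl.
move=> /hs[_ [[s _ <-] /= hg]]; exists (theta t (theta s sigma0)); split.
  by rewrite thetaD; exists (s + t).
apply: kV => /=; rewrite int_sqdist_theta; apply: le_lt_trans hg.
apply: ge0_subset_integral => //.
- exact: measurable_funS (measurable_sqdist _ _).
- apply: subset_itv; rewrite bnd_simp.
    by rewrite opprD lerD2r lerNl (le_trans (ler_norm _))// normrN.
  by rewrite lerD2r ler_norm.
Qed.

(** Makes the hull nonempty: over an empty family of symbols the supremum in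
    [uniformly_forward_attracts] would be -oo rather than 0. *)
Lemma hull_center (sigma0 : L2loc R) : hull sigma0 sigma0.
Proof. by apply: subset_closure; exists 0 => //; rewrite theta0. Qed.

Lemma is_derive_shiftl (V : normedModType R) (u : R -> V) (s t v : R) (d : V) :
  is_derive (s + t) v u d -> is_derive t v (fun x => u (s + x)) d.
Proof.
move=> [du <-].
have E1 : (fun h : R => h^-1 *: (((fun x => u (s + x)) \o shift t) (h *: v)
    - u (s + t))) = (fun h => h^-1 *: ((u \o shift (s + t)) (h *: v) - u (s + t))).
  by apply/funext => h /=; rewrite addrCA.
split; first by move: du; rewrite /derivable E1.
by rewrite /derive E1.
Qed.

Lemma absolutely_continuous_shift (s a b : R) (u : R -> E) :
  absolutely_continuous (s + a) (s + b) u ->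
  absolutely_continuous a b (fun x => u (s + x)).
Proof.
move=> ac e /ac[d d0 hd]; exists d => // l lab lpw ld.
have := hd [seq (s + p.1, s + p.2) | p <- l].
rewrite all_map pairwise_map !big_map /=; apply.
- by apply: sub_all lab => p /=; rewrite !lerD2l.
- by apply: sub_pairwise lpw => p q /=; rewrite lerD2l.
- by under eq_bigr do rewrite opprD addrACA subrr add0r.
Qed.

Lemma is_solution_shift (f : E -> E) (sigma : L2loc R) (t0 s : R) (u0 : E)
    (u : R -> E) : t0 <= s -> is_solution f sigma t0 u0 u ->
  is_solution f (theta s sigma) 0 (u s) (fun t => u (s + t)).
Proof.
move=> t0s [_ cu acu du]; split.
- by rewrite addr0.
- apply/subspace_continuousP => x; rewrite /= in_itv/= andbT => x0.
  have /subspace_continuousP/(_ (s + x)) := cu.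
  rewrite /= in_itv/= andbT (le_trans t0s) ?lerDl// => /(_ isT) cx.
  (* It remains that [y |-> s + y] tends to [s + x] within [[t0, +oo[] as [y] tends to [x] within
     [[0, +oo[]; this is where [t0 <= s] enters. *)
  apply: cvg_comp cx.
  move=> V; rewrite /within/= => VN.
  have sx : (fun y => s + y) @ x --> s + x by apply: cvgD; [exact: cvg_cst|exact: cvg_id].
  apply: (@filterS _ (nbhs x) _ _ _ _ (sx _ VN)) => y /=; rewrite !in_itv/= !andbT => h y0; apply: h.
  by rewrite (le_trans t0s)// lerDl.
- move=> b b0; apply: absolutely_continuous_shift; rewrite addr0.
  (* The modulus valid on [[t0, s + b]] also serves on the subinterval [[s, s + b]]. *)
  move=> e /(acu (s + b) _)[|d d0 hd]; first by rewrite (le_trans t0s)// lerDl.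
  exists d => // l lab; apply: hd; apply: sub_all lab => p /and3P[h1 -> ->].
  by rewrite (le_trans t0s).
- apply: filterS2 (ae_shift s du) (thetaE s sigma) => x dx -> x0.
  by apply: is_derive_shiftl; apply: dx; rewrite (le_lt_trans t0s)// ltrDl.
Qed.

Lemma generated_cocycle (f : E -> E) (Sigma : set (L2loc R))
    (U : L2loc R -> R -> R -> E -> E) (sigma : L2loc R) (s t : R) (u : E) :
  generated_by f Sigma U -> Sigma sigma -> Sigma (theta s sigma) ->
  0 <= s -> 0 <= t ->
  U (theta s sigma) t 0 (U sigma s 0 u) = U sigma (s + t) 0 u.
Proof.
move=> gen hs hss s0 t0; have [sol _] := gen sigma 0 u hs.
have [_ uniq] := gen (theta s sigma) 0 (U sigma s 0 u) hss.
by apply/esym; apply: (uniq (fun t => U sigma (s + t) 0 u)) => //;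
  exact: (is_solution_shift s0 sol).
Qed.

End translation.

(** * Bounded sets of the phase space *)

Section metric.
Variables (R : realType) (T : topologicalType).

(** Since [rho] induces the topology of [S], the function [rho x0] is continuous on [S], hence
    bounded by compactness; the triangle inequality through [x0] does the rest. *)
Lemma compact_metric_on_bounded (S : set T) (rho : T -> T -> R) :
  compact S -> metric_on S rho -> dist_bounded rho S.
Proof.
move=> cS [_ _ rsym rtri rnbhs].
have [->|/set0P[x0 Sx0]] := eqVneq S set0; first by exists 0.
have crho : {within S, continuous (rho x0 : T -> R)}.
  apply/subspace_continuousP => x Sx V /nbhs_ballP[e /= e0 eV].
  apply/rnbhs => //; exists e => // y Sy xy; apply: eV.
  rewrite /ball/= ltr_norml; apply/andP; split.
    by rewrite ltrNl opprB ltrBlDl (le_lt_trans (rtri _ x _ _ _ _))// ltrD2l.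
  rewrite ltrBlDl (le_lt_trans (rtri _ y _ _ _ _))// ltrD2l.
  by rewrite rsym.
have [M [_ hM]] := compact_bounded (continuous_compact crho cS).
(* Only numbers strictly above [M] are known to be bounds, hence [M + 1]. *)
have {}hM x : S x -> rho x0 x <= M + 1.
  move=> Sx; apply: le_trans (ler_norm _) _.
  by apply: (hM (M + 1)); [rewrite ltrDl|exists x].
exists (M + 1 + (M + 1)) => x y Sx Sy.
by rewrite (le_trans (rtri x x0 y Sx Sx0 Sy))// lerD ?hM// rsym// hM.
Qed.

Lemma prod_dist_bounded (rho : L2loc R -> L2loc R -> R) (B : set (ell2 R))
    (S : set (L2loc R)) :
  bounded_set B -> dist_bounded rho S -> dist_bounded (prod_dist rho) (B `*` S).
Proof.
move=> [M [_ hM]] [r hr]; exists (Num.max (M + 1 + (M + 1)) r).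
move=> [u s] [v s'] [/= Bu Ss] [/= Bv Ss'].
rewrite /prod_dist/= ge_max !le_max hr// orbT andbT.
rewrite (le_trans (ler_normB _ _))// lerD//.
  by apply: (hM (M + 1)) Bu; rewrite ltrDl.
by apply: (hM (M + 1)) Bv; rewrite ltrDl.
Qed.

End metric.

(** * Distance to a set and semidistance *)

Section semidistance.
Variables (R : realType) (X : Type) (d : X -> X -> R).

Lemma dist_set_self (A : set X) x : d x x = 0 -> A x -> (dist_set d x A <= 0)%E.
Proof. by move=> dx Ax; apply: ereal_inf_lbound; exists x => //; rewrite dx. Qed.

Lemma dist_set_le_semidist (A B : set X) x :
  A x -> (dist_set d x B <= semidist d A B)%E.
Proof. by move=> Ax; apply: ereal_sup_ubound; right; exists x. Qed.

Lemma semidist_subset (A B : set X) : (forall x, d x x = 0) -> A `<=` B ->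
  semidist d A B = 0%E.
Proof.
move=> dxx AB; apply/eqP; rewrite eq_le; apply/andP; split.
  apply: ge_ereal_sup => _ [->//|[x Ax <-]].
  by apply: dist_set_self => //; exact: AB.
(* The value 0 adjoined in [semidist] gives the lower bound, even for empty [A]. *)
by apply: ereal_sup_ubound; left.
Qed.

End semidistance.

(** * The forward invariant family *)

Theorem theorem3p1 (R : realType) (f : ell2 R -> ell2 R) (sigma0 : L2loc R)
    (rho : L2loc R -> L2loc R -> R)
    (U : L2loc R -> R -> R -> ell2 R -> ell2 R)
    (B0 : set (ell2 R)) (A : set (ell2 R * L2loc R)) :
  let Sigma := hull sigma0 in
  let phase := [set: ell2 R] `*` Sigma in
  translation_compact sigma0 ->
  metric_on Sigma rho ->
  generated_by f Sigma U ->
  continuous_processes Sigma U ->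
  bounded_set B0 ->
  uniformly_absorbing Sigma U B0 ->
  asymptotically_null_tails Sigma U B0 ->
  global_attractor phase (prod_dist rho) (skew_product U) A ->
  forall eps : R, 0 < eps ->
  exists Aeps : L2loc R -> set (ell2 R),
    [/\ forall sigma, Sigma sigma ->
          section A sigma `<=` Aeps sigma /\
          Aeps sigma `<=` section (neighborhood (prod_dist rho) phase A eps) sigma,
        forward_invariant Sigma U Aeps &
        forall B : set (ell2 R), bounded_set B ->
          uniformly_forward_attracts Sigma U Aeps B].
Proof.
move=> Sigma phase tc mrho gen _ _ _ _ [Aphase _ Ainv Aattr] eps eps0.
have cSigma : compact Sigma by move: tc; rewrite /translation_compact precompactE.
have Psi_phase t p : phase p -> phase (skew_product U t p).
  by move=> [_ Sp]; split => //; exact: hull_theta.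
have PsiD s t p : phase p -> 0 <= s -> 0 <= t ->
    skew_product U t (skew_product U s p) = skew_product U (s + t) p.
  move=> [_ Sp] s0 t0; rewrite /skew_product/= thetaD.
  by rewrite (generated_cocycle _ gen)//; exact: hull_theta.
have Psi0 p : phase p -> skew_product U 0 p = p.
  move: p => [u s] [_ Ss]; rewrite /skew_product/= theta0.
  by have [[-> _ _ _] _] := gen s 0 u Ss.
pose N := neighborhood (prod_dist rho) phase A eps.
pose trap := [set p | phase p /\ forall t, 0 <= t -> N (skew_product U t p)].
exists (section trap); split.
- move=> sigma Ssigma; split=> u /=.
  + move=> Aus; split; first exact: Aphase.
    move=> t t0; have APsi : A (skew_product U t (u, sigma)).
      by rewrite -(Ainv t t0); exists (u, sigma).
    split; first exact: Aphase.
    apply: le_lt_trans (dist_set_self _ APsi) _; last by rewrite lte_fin.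
    (* [rho] is known to vanish on the diagonal only over [Sigma], so the symbol of the point must
       first be placed there. *)
    have [_ Sp] := Aphase _ APsi; have [_ r0 _ _ _] := mrho.
    rewrite /prod_dist /ell2_dist subrr normr0.
    by have [_ ->//] := r0 _ _ Sp Sp; rewrite maxxx.
  (* At time 0 the orbit is at the point itself. *)
  + by move=> [us /(_ 0 (lexx 0))]; rewrite Psi0.
- move=> t sigma t0 Ssigma _ [u [us Nu] <-]; split.
    exact: (Psi_phase t (u, sigma)).
  by move=> s s0; rewrite [(_, _)]/(skew_product U t (u, sigma)) PsiD//; apply: Nu; exact: addr_ge0.
- move=> B bB.
  have BSb : dist_bounded (prod_dist rho) (B `*` Sigma).
    exact/prod_dist_bounded/compact_metric_on_bounded.
  have BSphase : B `*` Sigma `<=` phase by move=> p [].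
  have [T [_ hT]] : \forall t \near +oo%R,
      (semidist (prod_dist rho) (skew_product U t @` (B `*` Sigma)) A < eps%:E)%E.
    have eps0E : (0 < eps%:E)%E by rewrite lte_fin.
    exact: (Aattr _ BSphase BSb _ (open_ereal_lt' eps0E)).
  (* Beyond [T] the supremum is exactly 0; the maximum with 0 keeps [t] nonnegative, as the
     semigroup law requires. *)
  apply: cvg_near_cst; exists (Num.max T 0); split; first exact: num_real.
  move=> t; rewrite gt_max => /andP[Tt t0].
  rewrite (_ : [set _ | _ in _] = [set 0%E]) ?ereal_sup1//.
  suff h sigma : Sigma sigma -> semidist (@ell2_dist R) (U sigma t 0 @` B)
      (section trap (theta t sigma)) = 0%E.
    apply/seteqP; split=> [_ [s Ss <-]|_ ->]; first exact: h.
    by exists sigma0; [exact: hull_center|apply: h; exact: hull_center].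
  move=> Ss; apply: semidist_subset => [x|_ [u Bu <-]].
    by rewrite /ell2_dist subrr normr0.
  have us : phase (u, sigma) by [].
  split; first exact: (Psi_phase t (u, sigma)).
  move=> s s0; rewrite [(_, _)]/(skew_product U t (u, sigma)) PsiD ?(ltW t0)//.
  split; first exact: Psi_phase.
  (* The distance from one orbit point to [A] is at most the semidistance of the whole image of
     [B x Sigma], which is below [eps] at time [t + s > T]. *)
  apply: le_lt_trans (dist_set_le_semidist _ _ _) (hT (t + s) _).
    by exists (u, sigma).
  by rewrite (lt_le_trans Tt)// lerDl.
Qed.
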